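(* Let $M$ be an $\frac n2\times\frac n2$ preconditioner for $Y^TAY$ and $D$ an $\frac n2\times\frac n2$ preconditioner for $A_c$, and suppose that for constants $\kappa_s,\eta$ $$\frac{\big((M^T+M-Y^TAY)^{-1}Mu,\,Mu\big)}{(AYu,Yu)}\in[1,\kappa_s]\ \text{ for all } u\neq 0,\qquad \frac{(Dw,w)}{(A_cw,w)}\in[1,\eta]\ \text{ for all } w\ne 0 \text{ with } (w,\mathbf 1)=0.$$ Then $$\frac{(\widehat B v,v)}{(\widehat A v,v)}\in\big[1,\ (\kappa_s+\sigma\eta-1)\,|Q|_A^2\big]\qquad\text{for all } v\neq0 \text{ with } (v,\widehat{\mathbf 1})=0.$$
   Context: Let $\mathcal G=(\mathcal V,\mathcal E)$ be a finite connected unweighted graph with $n=|\mathcal V|\ge 4$ vertices, and let $A\in\mathbb R^{n\times n}$ be its graph Laplacian, $(Au,v)=\sum_{(i,j)\in\mathcal E}(u_i-u_j)(v_i-v_j)$. Here $(\cdot,\cdot)$ is the Euclidean inner product and $\mathbf 1$ is the vector of all ones. Let $\mathcal M=\{(i_k,j_k)\}_{k=1}^{n/2}$ be a perfect matching of $\mathcal G$ (a set of edges, no two incident, covering all vertices). With $e_i$ the standard basis vectors, $P$ and $Y$ are the $n\times \frac n2$ matrices with $k$-th columns $e_{i_k}+e_{j_k}$ and $e_{i_k}-e_{j_k}$, respectively. $Q=P(P^TP)^{-1}P^T$ is the $\ell_2$-orthogonal projection onto the range of $P$. With $|v|_A^2=(Av,v)$, $|Q|_A=\sup_{|v|_A\neq0}|Qv|_A/|v|_A$.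 The coarse graph $\mathcal G_c$ is the unweighted graph whose vertices are the edges of $\mathcal M$, two of them adjacent iff some edge of $\mathcal E$ joins a vertex of one to a vertex of the other; $A_c$ is the (unweighted) graph Laplacian of $\mathcal G_c$. Put $$\sigma=\sup_{v\ne0,\ (v,\mathbf 1)=0}\frac{(APv,Pv)}{(A_cv,v)}.$$ Let $(Y,P)$ be the $n\times n$ matrix with blocks $Y$ and $P$, let $\widehat A=(Y,P)^TA(Y,P)$, and let $\widehat{\mathbf 1}$ be the vector with $(Y,P)\widehat{\mathbf 1}=\mathbf 1$. Given $M$ invertible with $M+M^T-Y^TAY$ invertible, and $D$ symmetric positive semidefinite, define $$\widehat B=\widetilde L\begin{pmatrix}M(M+M^T-Y^TAY)^{-1}M^T&0\\0&\sigma D\end{pmatrix}\widetilde L^T,\qquad \widetilde L=\begin{pmatrix}I&0\\P^TAYM^{-1}&I\end{pmatrix}.$$ *)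

(* Defs.v *)
From mathcomp Require Import all_boot all_order all_algebra.
From mathcomp Require Import boolp classical_sets reals.
Set Implicit Arguments.
Unset Strict Implicit.
Unset Printing Implicit Defensive.
Import Order.TTheory GRing.Theory Num.Theory.
Local Open Scope ring_scope.

Definition simple_graph n (e : rel 'I_n) : Prop := symmetric e /\ irreflexive e.

Definition connected_graph n (e : rel 'I_n) : Prop :=
  forall x y : 'I_n, connect e x y.

Definition dot (R : realType) n (u v : 'cV[R]_n) : R :=
  \sum_(x < n) u x 0 * v x 0.

Definition ones (R : realType) n : 'cV[R]_n := const_mx 1.
Arguments ones {R n}.

(* The condition [x < y] counts every undirected edge exactly once. *)
Definition lap_form (R : realType) n (e : rel 'I_n) (u v : 'cV[R]_n) : R :=
  \sum_(x < n) \sum_(y < n | (x < y)%N && e x y)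
    (u x 0 - u y 0) * (v x 0 - v y 0).

(* The matrix representing [lap_form]; see [laplacianE]. *)
Definition laplacian (R : realType) n (e : rel 'I_n) : 'M[R]_n :=
  \matrix_(x, y) lap_form e (delta_mx x 0) (delta_mx y 0).
Arguments laplacian R {n} e.

Lemma laplacianE (R : realType) n (e : rel 'I_n) (u v : 'cV[R]_n) :
  dot (laplacian R e *m u) v = lap_form e u v.
Proof.
have sumE (w : 'cV[R]_n) a : w a 0 = \sum_x w x 0 * (delta_mx x 0 : 'cV_n) a 0.
  rewrite (bigD1 a) //= mxE !eqxx mulr1 big1 ?addr0 // => x /negPf nxa.
  by rewrite mxE eq_sym nxa mulr0.
have diffE (w : 'cV[R]_n) a b : w a 0 - w b 0 =
    \sum_x w x 0 * ((delta_mx x 0 : 'cV[R]_n) a 0 - (delta_mx x 0 : 'cV_n) b 0).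
  by under eq_bigr do rewrite mulrBr; rewrite sumrB -!sumE.
rewrite /dot.
transitivity (\sum_x \sum_y
    u y 0 * v x 0 * lap_form e (delta_mx x 0) (delta_mx y 0)).
  apply: eq_bigr => x _; rewrite mxE mulr_suml; apply: eq_bigr => y _.
  by rewrite !mxE -mulrA mulrC.
rewrite /lap_form.
under eq_bigr do under eq_bigr do rewrite mulr_sumr.
under eq_bigr do rewrite exchange_big.
rewrite exchange_big; apply: eq_bigr => a _.
under eq_bigr do under eq_bigr do rewrite mulr_sumr.
under eq_bigr do rewrite exchange_big.
rewrite exchange_big; apply: eq_bigr => b _.
rewrite (diffE u) (diffE v) mulrC mulr_suml; apply: eq_bigr => x _.
rewrite mulr_sumr; apply: eq_bigr => y _.
by rewrite [u y 0 * v x 0]mulrC mulrACA.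
Qed.

Section Matching.
Variables (n m : nat) (e : rel 'I_n) (i j : 'I_m -> 'I_n).

Definition matched_pair (k : 'I_m) : {set 'I_n} := [set i k; j k]%SET.

(* The [k]-th matching edge is [(i k, j k)]; for irreflexive [e] the conditions
   force [n = 2 * m]. *)
Definition perfect_matching : Prop :=
  [/\ forall k, e (i k) (j k),
      forall k l, k != l -> [disjoint matched_pair k & matched_pair l]
    & forall x, exists k, x \in matched_pair k].

Definition coarse_graph : rel 'I_m := fun k l =>
  (k != l) &&
  [exists x in matched_pair k, [exists y in matched_pair l, e x y]].

Variable R : realType.

Definition Pmx : 'M[R]_(n, m) :=
  \matrix_(x, k) ((x == i k)%:R + (x == j k)%:R).

Definition Ymx : 'M[R]_(n, m) :=
  \matrix_(x, k) ((x == i k)%:R - (x == j k)%:R).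

End Matching.

Arguments Pmx {n m} i j R.
Arguments Ymx {n m} i j R.

Definition range_proj (R : realType) n m (P : 'M[R]_(n, m)) : 'M[R]_n :=
  P *m invmx (P^T *m P) *m P^T.

Definition energy_norm (R : realType) n (A : 'M[R]_n) (v : 'cV[R]_n) : R :=
  Num.sqrt (dot (A *m v) v).

(* [sup] is real-valued, with junk value 0 on empty or unbounded sets. This
   does not arise for the projection of a matching: replacing values by
   averages over matched pairs is bounded in the energy seminorm. *)
Definition op_energy_norm (R : realType) n (A Q : 'M[R]_n) : R :=
  sup [set energy_norm A (Q *m v) / energy_norm A v
      | v in [set v : 'cV[R]_n | energy_norm A v != 0]]%classic.

(* For a perfect matching, the quotients below are at most 4, since at most
   four edges of the fine graph join two given matched pairs. *)
Definition coarse_sigma (R : realType) n m (A : 'M[R]_n) (P : 'M[R]_(n, m))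
    (Ac : 'M[R]_m) : R :=
  sup [set dot (A *m (P *m v)) (P *m v) / dot (Ac *m v) v
      | v in [set v : 'cV[R]_m | v != 0 /\ dot v ones = 0]]%classic.

Definition psd (R : realType) m (D : 'M[R]_m) : Prop :=
  D^T = D /\ forall w : 'cV[R]_m, 0 <= dot (D *m w) w.

Definition Ahat (R : realType) n m (A : 'M[R]_n) (Y P : 'M[R]_(n, m)) :
    'M[R]_(m + m) :=
  (row_mx Y P)^T *m A *m row_mx Y P.

Definition Ltilde (R : realType) n m (A : 'M[R]_n) (Y P : 'M[R]_(n, m))
    (M : 'M[R]_m) : 'M[R]_(m + m) :=
  block_mx 1%:M 0 (P^T *m A *m Y *m invmx M) 1%:M.

Definition Bhat (R : realType) n m (A : 'M[R]_n) (Y P : 'M[R]_(n, m))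
    (M D : 'M[R]_m) (sigma : R) : 'M[R]_(m + m) :=
  Ltilde A Y P M
  *m block_mx (M *m invmx (M + M^T - Y^T *m A *m Y) *m M^T) 0 0 (sigma *: D)
  *m (Ltilde A Y P M)^T.

(* Main.v *)
Require Import Defs.
From mathcomp Require Import all_boot all_order all_algebra.
From mathcomp Require Import boolp classical_sets reals.
From mathcomp Require Import ring lra.
Set Implicit Arguments.
Unset Strict Implicit.
Unset Printing Implicit Defensive.
Import Order.TTheory GRing.Theory Num.Theory.
Local Open Scope ring_scope.

(** The form of [Bhat] dominates that of [Ahat] because it is a smoother
followed by an inexact coarse solve, and the stated constant is what a
weighted Young inequality gives. Write [v = (x, y)], [w = Y x + P y],
[S = Y^T A Y], [N = M + M^T - S], [r = Y^T A P y], and let (.,.) with matrices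
in it stand for [dot]. Expanding the block factorizations
([Ahat_energyE], [Bhat_energyE]),

   (Ahat v, v) = (S x, x) + 2 (r, x) + (A P y, P y),
   (Bhat v, v) = (N^-1 (M^T x + r), M^T x + r) + sigma (D y, y).

The vector [hat1] is [(0, 1)], so the constraint on [v] only says that [y] has
mean zero; this is where sigma and the bounds on [D] apply.

Lower bound. [(N^-1 h, h)] is the maximum over q of [2 (h, q) - (N q, q)], and
q = x gives exactly [(S x, x) + 2 (r, x)]; moreover
[(A P y, P y) <= sigma (Ac y, y) <= sigma (D y, y)].

Upper bound. Let [S s = r], [t = x + s], and let [p = |P y|_A^2 - |s|_S^2] be
the Schur complement energy of [y], so that [(Ahat v, v) = |t|_S^2 + p]. Put
[g = |Q|_A^2]. As Q sends [P y - Y s] to [P y], we get [|P y|_A^2 <= g p],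
hence [|s|_S^2 <= (g - 1) p]. With [a = N^-1 (M^T x + r)], [S b = M a] and
[f = b - a], the smoother energy z equals both [|b|_S^2 - |f|_S^2] and
[(b, t)_S - (s, f)_S]. Here [f = (I - M^-1 S) b] is the error of one smoothing
step; if the smoother contracts it, [kappa |f|_S^2 <= (kappa - 1) |b|_S^2],
then [|b|_S^2 <= kappa z] and [|f|_S^2 <= (kappa - 1) z], and Cauchy-Schwarz
together with [weighted_young] yields
[z <= g (kappa |t|_S^2 + (kappa - 1) p)]. Adding
[sigma (D y, y) <= sigma eta |P y|_A^2 <= sigma eta g p] and using
[1 <= sigma eta] finishes the proof ([two_level_upper]).

The hypothesis bounds [M^T N^-1 M], whereas [Bhat] contains [M N^-1 M^T]. For a
nonsymmetric M these differ: the hypothesis says that [I - M^-T S] contracts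
([adjoint_contraction]). But that operator is the S-adjoint of [I - M^-1 S],
so the two have the same S-norm ([error_contraction]).

On the graph side one needs that the suprema sigma and [|Q|_A] are taken over
bounded sets, so that they really bound the quotients, and that
[(Ac y, y) <= (A P y, P y)]. All of this comes from grouping the fine edges
according to the matched pairs that they join. *)

(** * Inner products and semidefinite matrices *)

Section Dot.
Variable R : realType.

Lemma dotC n (u v : 'cV[R]_n) : dot u v = dot v u.
Proof. by apply: eq_bigr => x _; rewrite mulrC. Qed.

Lemma dotDl n (u v w : 'cV[R]_n) : dot (u + v) w = dot u w + dot v w.
Proof. by rewrite -big_split; apply: eq_bigr => x _; rewrite mxE mulrDl. Qed.

Lemma dotZl n a (u v : 'cV[R]_n) : dot (a *: u) v = a * dot u v.
Proof. by rewrite mulr_sumr; apply: eq_bigr => x _; rewrite mxE mulrA. Qed.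

Lemma dotBl n (u v w : 'cV[R]_n) : dot (u - v) w = dot u w - dot v w.
Proof. by rewrite dotDl -scaleN1r dotZl mulN1r. Qed.

Lemma dotDr n (u v w : 'cV[R]_n) : dot w (u + v) = dot w u + dot w v.
Proof. by rewrite dotC dotDl !(dotC w). Qed.

Lemma dotZr n a (u v : 'cV[R]_n) : dot v (a *: u) = a * dot v u.
Proof. by rewrite dotC dotZl dotC. Qed.

Lemma dotBr n (u v w : 'cV[R]_n) : dot w (u - v) = dot w u - dot w v.
Proof. by rewrite dotC dotBl !(dotC w). Qed.

Lemma dot0l n (u : 'cV[R]_n) : dot 0 u = 0.
Proof. by rewrite /dot big1 // => x _; rewrite mxE mul0r. Qed.

Lemma dotM n m (B : 'M[R]_(m, n)) (u : 'cV[R]_n) v :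
  dot (B *m u) v = dot u (B^T *m v).
Proof.
have dotE k (a b : 'cV[R]_k) : dot a b = (a^T *m b) 0 0.
  by rewrite mxE; apply: eq_bigr => x _; rewrite mxE.
by rewrite !dotE trmx_mul mulmxA.
Qed.

Lemma dot_col_mx n m (a c : 'cV[R]_n) (b d : 'cV[R]_m) :
  dot (col_mx a b) (col_mx c d) = dot a c + dot b d.
Proof.
rewrite /dot big_split_ord /=; congr (_ + _); apply: eq_bigr => x _.
  by rewrite !col_mxEu.
by rewrite !col_mxEd.
Qed.

Lemma psd_sym n (S : 'M[R]_n) u v : psd S -> dot (S *m u) v = dot (S *m v) u.
Proof. by case=> Ssym _; rewrite dotM Ssym dotC. Qed.

(** The value at [c u - d v] of the quadratic form is nonnegative for all
[c], [d]. *)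
Lemma psd_CauchySchwarz n (S : 'M[R]_n) u v : psd S ->
  dot (S *m u) v ^+ 2 <= dot (S *m u) u * dot (S *m v) v.
Proof.
move=> Spsd; case: (Spsd) => _ S0.
have quad c d : 0 <= c ^+ 2 * dot (S *m u) u - 2 * c * d * dot (S *m u) v
                     + d ^+ 2 * dot (S *m v) v.
  have := S0 (c *: u - d *: v).
  rewrite mulmxBr -!scalemxAr !(dotBl, dotBr, dotZl, dotZr) (psd_sym v u) //.
  by congr (_ <= _); ring.
(* The second instance proves the claim when [(S v, v)] is positive; when it
   vanishes, the first one is affine in [d], hence constant. *)
move: (quad 1) (quad (dot (S *m v) v) (dot (S *m u) v)) (S0 u) (S0 v).
set a := dot _ u; set b := dot _ v; set c := dot _ v => q1 q2 a0.
rewrite le_eqVlt => /orP[/eqP c0 | c_gt0]; last first.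
  rewrite -subr_ge0 -(pmulr_rge0 _ c_gt0).
  by move: q2; congr (_ <= _); ring.
rewrite -c0 mulr0; have [->|b0] := eqVneq b 0; first by rewrite expr0n.
have := q1 ((a + 1) / (2 * b)); rewrite -c0 mulr0 addr0.
have -> : 2 * 1 * ((a + 1) / (2 * b)) * b = a + 1 by field.
by rewrite expr1n mul1r opprD addrA subrr sub0r oppr_ge0 ler10.
Qed.

Lemma posdef_unitmx n (S : 'M[R]_n) :
  (forall u, u != 0 -> 0 < dot (S *m u) u) -> S \in unitmx.
Proof.
move=> Spos; rewrite -unitmx_tr -row_free_unit -kermx_eq0.
apply/rowV0P => w /sub_kermxP wS; apply/eqP/contraT => w0.
have := Spos w^T; rewrite trmx_eq0 => /(_ w0).
by rewrite -[S]trmxK -trmx_mul wS trmx0 dot0l ltxx.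
Qed.

End Dot.

(** * Energy of the smoother *)

(** If [1 < g], the weights [g] and [g / (g - 1)] in Young's inequality bound
the square of [z] by [z] times the right-hand side; they degenerate at
[g = 1], where the last hypothesis forces [Y = 0]. *)
Lemma weighted_young (R : realType) (kappa g z X Y t p : R) :
  1 <= kappa -> 1 <= g -> 0 <= z -> 0 <= t -> 0 <= p ->
  z = X - Y -> X ^+ 2 <= kappa * z * t ->
  Y ^+ 2 <= (kappa - 1) * z * ((g - 1) * p) ->
  z <= g * (kappa * t + (kappa - 1) * p).
Proof.
move=> kappa1 g1 z0 t0 p0 zE Xle Yle.
have k0 : 0 <= kappa - 1 by rewrite subr_ge0.
have rhs0 : 0 <= g * (kappa * t + (kappa - 1) * p).
  by rewrite mulr_ge0 ?addr_ge0 ?mulr_ge0 // (le_trans ler01).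
have [->//|/eqP z_neq0] := eqVneq z 0.
have z_gt0 : 0 < z by rewrite lt_def z0 andbT; apply/eqP.
rewrite -(ler_pM2l z_gt0).
have [gE|g_neq1] := eqVneq g 1.
  have Y0 : Y = 0.
    apply/eqP; rewrite -sqrf_eq0 eq_le sqr_ge0 andbT.
    by rewrite (le_trans Yle) // gE subrr mul0r mulr0.
  have -> : z * z = X ^+ 2 by rewrite zE Y0 subr0 expr2.
  apply: (le_trans Xle); rewrite gE mul1r.
  by have := mulr_ge0 z0 (mulr_ge0 k0 p0); nra.
have h : 0 < g - 1 by rewrite subr_gt0 lt_def g_neq1.
rewrite -(ler_pM2l h).
have sq : (g - 1) * (z * z) <= (g - 1) * (g * X ^+ 2) + g * Y ^+ 2.
  rewrite -subr_ge0 zE.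
  have -> : (g - 1) * (g * X ^+ 2) + g * Y ^+ 2 - (g - 1) * ((X - Y) * (X - Y))
    = ((g - 1) * X + Y) ^+ 2 by ring.
  exact: sqr_ge0.
apply: (le_trans sq).
have g0 : 0 <= g by rewrite (le_trans ler01).
have hg : 0 <= (g - 1) * g by rewrite mulr_ge0 // ltW.
have := ler_wpM2l hg Xle; have := ler_wpM2l g0 Yle; nra.
Qed.

Section Smoother.
Variables (R : realType) (m : nat) (S M : 'M[R]_m) (kappa : R).
Let N := M + M^T - S.
Hypothesis Spsd : psd S.
Hypothesis Spos : forall u, u != 0 -> 0 < dot (S *m u) u.
Hypotheses (Munit : M \in unitmx) (Nunit : N \in unitmx).
Hypothesis lower :
  forall u, dot (S *m u) u <= dot (invmx N *m (M *m u)) (M *m u).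
Hypothesis upper : forall u,
  dot (invmx N *m (M *m u)) (M *m u) <= kappa * dot (S *m u) u.
Hypothesis kappa1 : 1 <= kappa.

Lemma dot_defect u : dot (N *m u) u = 2 * dot (M *m u) u - dot (S *m u) u.
Proof.
rewrite /N mulmxBl mulmxDl dotBl dotDl (dotM M^T) trmxK (dotC u); ring.
Qed.

(** The lower smoothing bound at [u = M^-1 N p] reads
[(S u, u) <= (p, N p)]. *)
Lemma defect_psd : psd N.
Proof.
split=> [|p]; first by rewrite !linearB linearD /= trmxK Spsd.1 /N (addrC M).
have := lower (invmx M *m (N *m p)); rewrite mulKVmx // mulKmx //.
by rewrite [leRHS]dotC; exact/le_trans/Spsd.2.
Qed.

(** Here [d - q] is [(I - M^-T S) d]. Cauchy-Schwarz in N turns the upper bound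
on [M^T N^-1 M] into [|d|_S^2 <= kappa (N q, q)], and
[(N q, q) = |d|_S^2 - |d - q|_S^2]. *)
Lemma adjoint_contraction d q : M^T *m q = S *m d ->
  kappa * dot (S *m (d - q)) (d - q) <= (kappa - 1) * dot (S *m d) d.
Proof.
move=> Mq; set p := invmx N *m (M *m d).
have Np : N *m p = M *m d by rewrite mulKVmx.
have dE : dot (S *m d) d = dot (N *m p) q by rewrite Np (dotM M) Mq dotC.
have := psd_CauchySchwarz p q defect_psd; rewrite -dE (dot_defect q).
have -> : dot (N *m p) p = dot p (M *m d) by rewrite Np dotC.
have -> : dot (M *m q) q = dot (S *m d) q by rewrite (dotM M) Mq dotC.
rewrite mulmxBr !(dotBl, dotBr) (psd_sym q d Spsd).
move: (upper d) (Spsd.2 d) (Spsd.2 q); rewrite -/p.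
have := defect_psd.2 q; rewrite dot_defect.
have -> : dot (M *m q) q = dot (S *m d) q by rewrite (dotM M) Mq dotC.
set a := dot _ d; set b := dot _ q; set c := dot _ q; set z := dot p _.
move=> N0 za a0 c0 cs.
suff : a <= kappa * (2 * b - c) by nra.
have [->|/eqP a_neq0] := eqVneq a 0;
  first by rewrite mulr_ge0 // (le_trans ler01).
have a_gt0 : 0 < a by rewrite lt_def a0 andbT; apply/eqP.
rewrite -(ler_pM2l a_gt0); nra.
Qed.

(** [b - a] is [(I - M^-1 S) b]. With [f = b - a], moving the operator to its
S-adjoint gives [|f|_S^2 = (b, (I - M^-T S) f)_S], and Cauchy-Schwarz passes the
contraction factor from the adjoint to the operator. *)
Lemma error_contraction a b : M *m a = S *m b ->
  kappa * dot (S *m (b - a)) (b - a) <= (kappa - 1) * dot (S *m b) b.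
Proof.
move=> Ma; set f := b - a; set q := invmx M^T *m (S *m f).
have Mq : M^T *m q = S *m f by rewrite mulKVmx // unitmx_tr.
have := psd_CauchySchwarz b (f - q) Spsd.
have -> : dot (S *m b) (f - q) = dot (S *m f) f.
  have -> : dot (S *m f) f = dot (S *m f) b - dot (S *m f) a.
    by rewrite -dotBr.
  rewrite dotBr (psd_sym b f Spsd); congr (_ - _).
  by rewrite -Ma -Mq dotM dotC.
move: (adjoint_contraction Mq) (Spsd.2 f) (Spsd.2 b).
set y := dot _ f; set z := dot _ (f - q); set w := dot _ b.
move=> yz y0 w0 cs.
have [->|/eqP y_neq0] := eqVneq y 0;
  first by rewrite mulr0 mulr_ge0 // subr_ge0.
have y_gt0 : 0 < y by rewrite lt_def y0 andbT; apply/eqP.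
rewrite -(ler_pM2l y_gt0).
have := ler_wpM2l (le_trans ler01 kappa1) cs.
have := ler_wpM2l w0 yz; lra.
Qed.

(** The two expressions for the smoother energy, [zdef] and [zE], are the heart
of the upper bound: the first controls the S-norms of [b] and [b - a] by the
energy itself, the second makes the energy linear in [x + s] and [s]. *)
Lemma smoother_energy_bound (g p : R) x s : 1 <= g -> 0 <= p ->
  dot (S *m s) s <= (g - 1) * p ->
  dot (invmx N *m (M^T *m x + S *m s)) (M^T *m x + S *m s)
    <= g * (kappa * dot (S *m (x + s)) (x + s) + (kappa - 1) * p).
Proof.
move=> g1 p0 sp; set a := invmx N *m _; set rhs := _ + _.
set b := invmx S *m (M *m a).
have Sb : S *m b = M *m a by rewrite mulKVmx // posdef_unitmx.
have Na : N *m a = rhs by rewrite mulKVmx.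
have zN : dot a rhs = dot (N *m a) a by rewrite Na dotC.
have zdef : dot a rhs = dot (S *m b) b - dot (S *m (b - a)) (b - a).
  rewrite zN dot_defect -Sb mulmxBr !(dotBl, dotBr) (psd_sym a b Spsd); ring.
have zE : dot a rhs = dot (S *m b) (x + s) - dot (S *m s) (b - a).
  rewrite /rhs dotDr Sb dotBr dotDr -Sb (psd_sym s b Spsd) Sb (dotM M a).
  rewrite (dotC a (S *m s)); ring.
have := error_contraction (esym Sb).
move: (psd_CauchySchwarz b (x + s) Spsd) (psd_CauchySchwarz s (b - a) Spsd).
have z0 : 0 <= dot a rhs by rewrite zN; apply: defect_psd.2.
move: zdef z0; have := Spsd.2 s; have := Spsd.2 (b - a); have := Spsd.2 b.
have t0 := Spsd.2 (x + s).
set f2 := dot _ (b - a); set b2 := dot _ b; set z := dot a _.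
move=> b20 f20 s20 zdef z0 cs1 cs2 con.
have k0 : 0 <= kappa - 1 by rewrite subr_ge0.
have bz : b2 <= kappa * z by nra.
have fz : f2 <= (kappa - 1) * z by nra.
apply: (weighted_young kappa1 g1 z0 t0 p0 zE).
  by apply: (le_trans cs1); rewrite ler_wpM2r.
apply: (le_trans cs2); rewrite mulrC.
by apply: ler_pM.
Qed.

(** With [a = N^-1 (M^T x + r)], the difference of the two sides is
[(N (a - x), a - x)]. *)
Lemma smoother_energy_lower x r :
  dot (S *m x) x + 2 * dot r x
    <= dot (invmx N *m (M^T *m x + r)) (M^T *m x + r).
Proof.
set rhs := M^T *m x + r; set a := invmx N *m rhs.
have Na : N *m a = rhs by rewrite mulKVmx.
have := defect_psd.2 (a - x); rewrite mulmxBr !(dotBl, dotBr).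
rewrite (psd_sym x a defect_psd) Na (dot_defect x).
rewrite (dotC rhs a) {2}/rhs dotDl (dotM M^T) trmxK (dotC x); lra.
Qed.

End Smoother.

(** * Graph Laplacians *)

Section Laplacian.
Variables (R : realType) (n : nat) (e : rel 'I_n).

Lemma lap_formC (u v : 'cV[R]_n) : lap_form e u v = lap_form e v u.
Proof. by do 2!apply: eq_bigr => ? _; rewrite mulrC. Qed.

Lemma lap_form_ge0 (u : 'cV[R]_n) : 0 <= lap_form e u u.
Proof. by do 2!apply: sumr_ge0 => ? _; rewrite -expr2 sqr_ge0. Qed.

Lemma laplacian_psd : psd (laplacian R e).
Proof.
split; first by apply/matrixP => x y; rewrite !mxE lap_formC.
by move=> w; rewrite laplacianE lap_form_ge0.
Qed.

Hypothesis esimple : simple_graph e.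

Lemma edge_energy_le (u : 'cV[R]_n) x y :
  e x y -> (u x 0 - u y 0) ^+ 2 <= lap_form e u u.
Proof.
have sq a b : 0 <= (u a 0 - u b 0) * (u a 0 - u b 0) by rewrite -expr2 sqr_ge0.
wlog xy : x y / (x < y)%N => [hwlog exy|exy].
  have [xy|yx|/val_inj xy] := ltngtP x y; first exact: hwlog.
    by rewrite -opprB sqrrN; apply: hwlog; rewrite // esimple.1.
  by rewrite xy esimple.2 in exy.
rewrite /lap_form (bigD1 x) //= (bigD1 y) /= ?xy // -expr2 -addrA lerDl.
by rewrite addr_ge0 ?sumr_ge0 // => a _; rewrite sumr_ge0.
Qed.

(** Summing over ordered pairs removes the condition [x < y], which the
regrouping by matched pairs would not preserve. *)
Lemma lap_form_double (u : 'cV[R]_n) :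
  2 * lap_form e u u = \sum_x \sum_y (e x y)%:R * (u x 0 - u y 0) ^+ 2.
Proof.
rewrite mulr_natl mulr2n; set F := fun x y : 'I_n =>
  (if (x < y)%N && e x y then (u x 0 - u y 0) * (u x 0 - u y 0) else 0).
have -> : lap_form e u u = \sum_x \sum_y F x y.
  by apply: eq_bigr => x _; rewrite big_mkcond.
rewrite [X in _ + X = _]exchange_big -big_split; apply: eq_bigr => x _ /=.
rewrite -big_split; apply: eq_bigr => y _ /=; rewrite /F (esimple.1 y x).
have [xy|yx|/val_inj ->] := ltngtP x y; last by rewrite esimple.2 mul0r addr0.
  by case: (e x y); rewrite ?mul1r ?mul0r addr0.
by case: (e x y); rewrite ?mul1r ?mul0r add0r // -expr2 -opprB sqrrN.
Qed.

Lemma lap_form_eq0 (u : 'cV[R]_n) y :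
  connected_graph e -> lap_form e u u = 0 -> u = u y 0 *: ones.
Proof.
move=> econ u0; apply/matrixP => x c; rewrite ord1 [RHS]mxE /ones mxE mulr1.
have /connectP[p] := econ x y.
elim: p x => [x _ -> //|z p IHp x /= /andP[exz zp] yE].
rewrite -(IHp z) //; apply/eqP; rewrite -subr_eq0 -sqrf_eq0 eq_le sqr_ge0 andbT.
by rewrite -u0 edge_energy_le.
Qed.

End Laplacian.

(** * Perfect matchings and the coarse graph *)

Section MatchingGraph.
Variables (R : realType) (n m : nat) (e : rel 'I_n) (i j : 'I_m -> 'I_n).
Hypotheses (esimple : simple_graph e) (ematch : perfect_matching e i j).

Let P := Pmx i j R.
Let Y := Ymx i j R.

Lemma matched_pair_inj k l x :
  x \in matched_pair i j k -> x \in matched_pair i j l -> k = l.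
Proof.
case: ematch => _ disj _ xk xl; apply/eqP/contraT => /disj/pred0P/(_ x) /=.
by rewrite xk xl.
Qed.

Lemma mem_fst k : i k \in matched_pair i j k.
Proof. by rewrite !inE eqxx. Qed.

Lemma mem_snd k : j k \in matched_pair i j k.
Proof. by rewrite !inE eqxx orbT. Qed.

Lemma fst_neq_snd k : i k == j k = false.
Proof.
by case: ematch => /(_ k) eij _ _; apply/eqP => ijE; rewrite ijE esimple.2 in eij.
Qed.

Lemma fst_eq_fst k l : (i k == i l) = (k == l).
Proof.
apply/eqP/eqP => [il|->//]; apply: matched_pair_inj (mem_fst k) _.
by rewrite il mem_fst.
Qed.

Lemma snd_eq_snd k l : (j k == j l) = (k == l).
Proof.
apply/eqP/eqP => [jl|->//]; apply: matched_pair_inj (mem_snd k) _.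
by rewrite jl mem_snd.
Qed.

Lemma fst_eq_snd k l : (i k == j l) = false.
Proof.
apply/eqP => ij; suff kl : k = l by have := fst_neq_snd k; rewrite ij kl eqxx.
by apply: matched_pair_inj (mem_fst k) _; rewrite ij mem_snd.
Qed.

Lemma sum_matched_pairs (F : 'I_n -> R) :
  \sum_x F x = \sum_k (F (i k) + F (j k)).
Proof.
case: ematch => _ disj cov.
have <- : \sum_(x in \bigcup_k matched_pair i j k) F x = \sum_x F x.
  apply: eq_bigl => x; have [k xk] := cov x.
  by apply/bigcupP; exists k.
rewrite partition_disjoint_bigcup //; apply: eq_bigr => k _.
by rewrite big_setU1 ?inE ?fst_neq_snd // big_set1.
Qed.

Lemma trPmx_mulE p (B : 'M[R]_(n, p)) k c :
  (P^T *m B) k c = B (i k) c + B (j k) c.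
Proof.
rewrite mxE sum_matched_pairs (bigD1 k) //= big1 => [|l lk]; rewrite !mxE;
  rewrite fst_eq_fst snd_eq_snd fst_eq_snd (eq_sym (j _)) fst_eq_snd ?eqxx.
  by rewrite !(mulr1n, mulr0n); ring.
by rewrite (negPf lk) !mulr0n; ring.
Qed.

Lemma trYmx_mulE p (B : 'M[R]_(n, p)) k c :
  (Y^T *m B) k c = B (i k) c - B (j k) c.
Proof.
rewrite mxE sum_matched_pairs (bigD1 k) //= big1 => [|l lk]; rewrite !mxE;
  rewrite fst_eq_fst snd_eq_snd fst_eq_snd (eq_sym (j _)) fst_eq_snd ?eqxx.
  by rewrite !(mulr1n, mulr0n); ring.
by rewrite (negPf lk) !mulr0n; ring.
Qed.

Lemma trPmx_Pmx : P^T *m P = 2%:M.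
Proof.
apply/matrixP => k l; rewrite trPmx_mulE !mxE fst_eq_fst snd_eq_snd fst_eq_snd.
by rewrite (eq_sym (j _)) fst_eq_snd; case: eqP => _;
  rewrite !(mulr1n, mulr0n); ring.
Qed.

Lemma trYmx_Ymx : Y^T *m Y = 2%:M.
Proof.
apply/matrixP => k l; rewrite trYmx_mulE !mxE fst_eq_fst snd_eq_snd fst_eq_snd.
by rewrite (eq_sym (j _)) fst_eq_snd; case: eqP => _;
  rewrite !(mulr1n, mulr0n); ring.
Qed.

Lemma trPmx_Ymx : P^T *m Y = 0.
Proof.
apply/matrixP => k l; rewrite trPmx_mulE !mxE fst_eq_fst snd_eq_snd fst_eq_snd.
by rewrite (eq_sym (j _)) fst_eq_snd subr0 sub0r subrr.
Qed.

Lemma trYmx_Pmx : Y^T *m P = 0.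
Proof. by rewrite -[P]trmxK -trmx_mul trPmx_Ymx trmx0. Qed.

Lemma Pmx_mulE (y : 'cV[R]_m) k x :
  x \in matched_pair i j k -> (P *m y) x 0 = y k 0.
Proof.
rewrite !inE mxE => xk; rewrite (bigD1 k) //= big1 => [|l lk]; rewrite mxE.
  by case/orP: xk => /eqP ->; rewrite eqxx ?(eq_sym (j k)) fst_eq_snd ?addr0 ?add0r mul1r.
have kl : (k == l) = false by rewrite eq_sym (negPf lk).
by case/orP: xk => /eqP ->; rewrite ?(eq_sym (j k) (i l)) fst_eq_snd ?fst_eq_fst
  ?snd_eq_snd kl addr0 mul0r.
Qed.

(** The ranges of Y and P are orthogonal, so Q removes the Y part. *)
Lemma range_projE (x y : 'cV[R]_m) : range_proj P *m (Y *m x + P *m y) = P *m y.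
Proof.
rewrite /range_proj trPmx_Pmx invmx_scalar mulmxDr -!mulmxA (mulmxA P^T Y).
rewrite trPmx_Ymx mul0mx !mulmx0 add0r (mulmxA P^T P) trPmx_Pmx !mul_scalar_mx.
by rewrite scalerA mulVf ?scale1r // pnatr_eq0.
Qed.

(** The columns of [(Y, P)] are orthogonal, so that the coordinates are read off
by applying [Y^T] and [P^T]; Y^T kills constants. *)
Lemma block_const (x y : 'cV[R]_m) a :
  Y *m x + P *m y = a *: ones -> x = 0 /\ y = a *: ones.
Proof.
have halve (u w : 'cV[R]_m) : 2%:M *m u = 2 *: w -> u = w.
  by rewrite mul_scalar_mx; apply: scalerI; rewrite pnatr_eq0.
move=> wE; split; apply: halve.
  rewrite -trYmx_Ymx -mulmxA -[LHS]addr0 -[X in _ + X](mul0mx _ y) -trYmx_Pmx.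
  rewrite -mulmxA -mulmxDr wE; apply/matrixP => k c.
  by rewrite trYmx_mulE !mxE subrr mulr0.
rewrite -trPmx_Pmx -mulmxA -[LHS]add0r -[X in X + _](mul0mx _ x) -trPmx_Ymx.
rewrite -mulmxA -mulmxDr wE; apply/matrixP => k c.
by rewrite trPmx_mulE !mxE; ring.
Qed.

Lemma coarse_simple : simple_graph (coarse_graph e i j).
Proof.
split=> [k l|k]; last by rewrite /coarse_graph eqxx.
rewrite /coarse_graph eq_sym; congr (_ && _).
by apply/exists_inP/exists_inP => -[x xk /exists_inP[y yl exy]];
  exists y => //; apply/exists_inP; exists x; rewrite // esimple.1.
Qed.

Lemma aggregate_energyE (y : 'cV[R]_m) : 2 * lap_form e (P *m y) (P *m y) =
  \sum_k \sum_l ((e (i k) (i l))%:R + (e (i k) (j l))%:R + (e (j k) (i l))%:R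
                 + (e (j k) (j l))%:R) * (y k 0 - y l 0) ^+ 2.
Proof.
rewrite lap_form_double // sum_matched_pairs; apply: eq_bigr => k _.
rewrite !sum_matched_pairs -big_split; apply: eq_bigr => l _ /=.
by rewrite !(Pmx_mulE _ (mem_fst _)) !(Pmx_mulE _ (mem_snd _)); ring.
Qed.

Lemma coarse_graphE k l : coarse_graph e i j k l =
  (k != l) && [|| e (i k) (i l), e (i k) (j l), e (j k) (i l) | e (j k) (j l)].
Proof.
congr (_ && _); apply/exists_inP/idP => [[x xk /exists_inP[y yl]]|].
  move: xk yl; rewrite !inE => /orP[]/eqP-> /orP[]/eqP-> ->; rewrite ?orbT //.
case/or4P=> exy; [exists (i k)|exists (i k)|exists (j k)|exists (j k)];
  rewrite ?mem_fst ?mem_snd //; apply/exists_inP;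
  [exists (i l)|exists (j l)|exists (i l)|exists (j l)];
  by rewrite ?mem_fst ?mem_snd.
Qed.

(** Every coarse edge comes from at least one and at most four fine edges, while
the fine edges inside a matched pair do not contribute. *)
Lemma coarse_energy_le (y : 'cV[R]_m) :
  lap_form (coarse_graph e i j) y y <= lap_form e (P *m y) (P *m y)
    <= 4 * lap_form (coarse_graph e i j) y y.
Proof.
rewrite -(ler_pM2l (ltr0Sn R 1)) -[X in _ && X](ler_pM2l (ltr0Sn R 1)).
rewrite mulrCA aggregate_energyE (lap_form_double coarse_simple).
rewrite mulr_sumr; apply/andP; split; apply: ler_sum => k _;
  rewrite ?mulr_sumr; apply: ler_sum => l _.
  apply: ler_wpM2r; first exact: sqr_ge0.
  rewrite coarse_graphE; case: eqP => _ /=; first by rewrite !addr_ge0.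
  by do 4!case: (e _ _) => //=; rewrite -?natrD ler_nat.
rewrite [leRHS]mulrA.
have [->|kl] := eqVneq k l; first by rewrite subrr expr0n !mulr0.
apply: ler_wpM2r; first exact: sqr_ge0.
rewrite coarse_graphE kl /=.
by do 4!case: (e _ _) => //=; rewrite -?natrD -?natrM ler_nat.
Qed.

(** A crude bound whose only purpose is that the supremum defining [|Q|_A] is
over a bounded set. The pair averages [z k] and [z l] across a coarse edge
differ by at most twice the root of the energy of [w]: half a matching edge, one
joining edge, half a matching edge. *)
Lemma range_proj_energy_le (w : 'cV[R]_n) :
  lap_form e (range_proj P *m w) (range_proj P *m w)
    <= 4 * (9 * (m * m)%:R) * lap_form e w w.
Proof.
set E := lap_form e w w; have E0 : 0 <= E by exact: lap_form_ge0.
pose z := 2^-1 *: (P^T *m w).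
have -> : range_proj P *m w = P *m z.
  by rewrite /range_proj trPmx_Pmx invmx_scalar -!mulmxA mul_scalar_mx.
have [_ /le_trans-> //] := andP (coarse_energy_le z).
rewrite -mulrA; apply: ler_wpM2l => //.
have near k x : x \in matched_pair i j k -> (2 * (z k 0 - w x 0)) ^+ 2 <= E.
  move=> xk; have -> : z k 0 = 2^-1 * (w (i k) 0 + w (j k) 0).
    by rewrite mxE trPmx_mulE.
  have eij : e (i k) (j k) by case: ematch.
  move: xk (edge_energy_le esimple w eij); rewrite !inE.
  by case/orP=> /eqP->; congr (_ <= _); field.
have step k l : coarse_graph e i j k l -> (z k 0 - z l 0) ^+ 2 <= 9 * E.
  case/andP=> _ /exists_inP[x /near hx] /exists_inP[y /near hy].
  move/(edge_energy_le esimple w); rewrite -/E; move: hx hy.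
  have -> : z k 0 - z l 0 = (z k 0 - w x 0) - (z l 0 - w y 0) + (w x 0 - w y 0).
    by ring.
  move: (z k 0 - _) (z l 0 - _) (w x 0 - _) => a b c ha hb hc.
  have := sqr_ge0 (a + b); have := sqr_ge0 (a - c); have := sqr_ge0 (b + c); nra.
rewrite -(ler_pM2l (ltr0Sn R 1)) (lap_form_double coarse_simple).
apply: (@le_trans _ _ (\sum_(k < m) \sum_(l < m) 9 * E)).
  apply: ler_sum => k _; apply: ler_sum => l _.
  have [/step kl|_] := boolP (coarse_graph e i j k l); first by rewrite mul1r.
  by rewrite mul0r mulr_ge0.
rewrite !sumr_const !card_ord -mulrnA -mulr_natl.
have := mulr_ge0 (ler0n R (m * m)) E0; nra.
Qed.

End MatchingGraph.

(** * The suprema as bounds *)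

Section Suprema.
Variable R : realType.

Lemma op_energy_norm_bound n (A Q : 'M[R]_n) C v : psd A ->
  (forall u, dot (A *m (Q *m u)) (Q *m u) <= C * dot (A *m u) u) ->
  dot (A *m (Q *m v)) (Q *m v) <= op_energy_norm A Q ^+ 2 * dot (A *m v) v.
Proof.
move=> [_ A0] AQ; have := A0 v; rewrite le_eqVlt => /orP[/eqP v0|v_gt0].
  by rewrite -v0 mulr0; have := AQ v; rewrite -v0 mulr0.
have nv : 0 < energy_norm A v by rewrite sqrtr_gt0.
have ratio : energy_norm A (Q *m v) / energy_norm A v <= op_energy_norm A Q.
  apply: ub_le_sup; last by exists v => //=; rewrite gt_eqF.
  exists (Num.sqrt C) => _ [u u0 <-].
  have nu : 0 < energy_norm A u by rewrite lt_def u0 sqrtr_ge0.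
  rewrite ler_pdivrMr //.
  have [C0|C0] := leP 0 C.
    by rewrite -sqrtrM // ler_wsqrtr.
  rewrite [leLHS]ler0_sqrtr ?mulr_ge0 ?sqrtr_ge0 //.
  by apply: (le_trans (AQ u)); rewrite mulr_le0_ge0 // ltW.
rewrite -[leLHS]sqr_sqrtr // -[dot (A *m v) v]sqr_sqrtr // -exprMn.
rewrite lerXn2r ?nnegrE ?mulr_ge0 ?sqrtr_ge0 //.
  by apply: le_trans ratio; rewrite divr_ge0 ?sqrtr_ge0.
by rewrite -ler_pdivrMr.
Qed.

Lemma coarse_sigma_bound n m (A : 'M[R]_n) (P : 'M[R]_(n, m)) (Ac : 'M[R]_m) C v :
  (forall u, u != 0 -> dot u ones = 0 ->
     0 < dot (Ac *m u) u
       /\ dot (A *m (P *m u)) (P *m u) <= C * dot (Ac *m u) u) ->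
  v != 0 -> dot v ones = 0 ->
  dot (A *m (P *m v)) (P *m v) <= coarse_sigma A P Ac * dot (Ac *m v) v.
Proof.
move=> AP v0 v1; rewrite -ler_pdivrMr; last exact: (AP v v0 v1).1.
apply: ub_le_sup; last by exists v.
by exists C => _ [u [u0 u1] <-]; have [? ?] := AP u u0 u1; rewrite ler_pdivrMr.
Qed.

End Suprema.

(** * The two-level preconditioner *)

Section TwoLevel.
Variables (R : realType) (n m : nat) (A : 'M[R]_n) (Y P : 'M[R]_(n, m)).
Variables (M D : 'M[R]_m) (sigma kappa : R).
Hypothesis Apsd : psd A.
Let S := Y^T *m A *m Y.
Let N := M + M^T - S.

Lemma block_energyE x y :
  dot (A *m (Y *m x + P *m y)) (Y *m x + P *m y) = dot (S *m x) x
    + 2 * dot (Y^T *m A *m P *m y) x + dot (A *m (P *m y)) (P *m y).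
Proof.
rewrite mulmxDr !(dotDl, dotDr) (psd_sym (Y *m x) (P *m y) Apsd).
rewrite -!mulmxA !(dotM Y^T) trmxK; ring.
Qed.

Lemma Ahat_energyE x y : dot (Ahat A Y P *m col_mx x y) (col_mx x y)
  = dot (A *m (Y *m x + P *m y)) (Y *m x + P *m y).
Proof. by rewrite /Ahat -!mulmxA dotM trmxK mul_row_col. Qed.

Lemma Bhat_energyE x y : M \in unitmx ->
  dot (Bhat A Y P M D sigma *m col_mx x y) (col_mx x y)
    = dot (invmx N *m (M^T *m x + Y^T *m A *m P *m y))
          (M^T *m x + Y^T *m A *m P *m y)
      + sigma * dot (D *m y) y.
Proof.
move=> Munit; rewrite /Bhat -!mulmxA dotM /Ltilde tr_block_mx mul_block_col.
rewrite mul_block_col dot_col_mx !trmx1 !trmx0 !mul1mx !mul0mx add0r addr0 add0r.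
rewrite -scalemxAl dotZl; congr (_ + _).
set z := x + _; rewrite (_ : M^T *m x + _ = M^T *m z).
  by rewrite -!mulmxA dotM /N /S -!mulmxA.
rewrite mulmxDr; congr (_ + _); rewrite !trmx_mul trmxK trmx_inv !mulmxA.
by rewrite mulmxV ?unitmx_tr // mul1mx Apsd.1.
Qed.

Hypotheses (Munit : M \in unitmx) (Nunit : N \in unitmx).
Hypothesis Spos : forall u, u != 0 -> 0 < dot (S *m u) u.
Hypothesis smooth_lower :
  forall u, dot (S *m u) u <= dot (invmx N *m (M *m u)) (M *m u).
Hypothesis smooth_upper : forall u,
  dot (invmx N *m (M *m u)) (M *m u) <= kappa * dot (S *m u) u.

Lemma smoothing_block_psd : psd S.
Proof.
split; first by rewrite /S !trmx_mul trmxK Apsd.1 mulmxA.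
by move=> u; rewrite /S -!mulmxA dotM trmxK; apply: Apsd.2.
Qed.

Lemma two_level_lower x y :
  dot (A *m (P *m y)) (P *m y) <= sigma * dot (D *m y) y ->
  dot (Ahat A Y P *m col_mx x y) (col_mx x y)
    <= dot (Bhat A Y P M D sigma *m col_mx x y) (col_mx x y).
Proof.
move=> Dy; rewrite Ahat_energyE block_energyE Bhat_energyE // lerD //.
exact: smoother_energy_lower smoothing_block_psd Munit Nunit smooth_lower _ _.
Qed.

(** [tau] stands for sigma times eta. The bound [Pg] is used at [u = - s], where
the energy on its right-hand side is minimal, namely the Schur complement
energy [p]. *)
Lemma two_level_upper (g tau : R) x y : 1 <= kappa -> 1 <= g -> 1 <= tau ->
  (forall u, dot (A *m (P *m y)) (P *m y)
     <= g * dot (A *m (Y *m u + P *m y)) (Y *m u + P *m y)) ->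
  sigma * dot (D *m y) y <= tau * dot (A *m (P *m y)) (P *m y) ->
  dot (Bhat A Y P M D sigma *m col_mx x y) (col_mx x y)
    <= (kappa + tau - 1) * g * dot (Ahat A Y P *m col_mx x y) (col_mx x y).
Proof.
move=> k1 g1 tau1 Pg Dy; rewrite Ahat_energyE block_energyE Bhat_energyE //.
set r := Y^T *m A *m P *m y; set c := dot (A *m (P *m y)) (P *m y).
pose s := invmx S *m r; have Ss : S *m s = r by rewrite mulKVmx // posdef_unitmx.
pose p := c - dot (S *m s) s.
have cp : c <= g * p.
  have := Pg (- s); rewrite block_energyE -/r -Ss !mulmxN -/c.
  have neg (u v : 'cV[R]_m) : dot u (- v) = - dot u v.
    by rewrite -scaleN1r dotZr mulN1r.
  rewrite neg neg dotC neg (dotC s) opprK /p; congr (_ <= g * _); ring.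
have g0 : 0 < g := lt_le_trans ltr01 g1.
have p0 : 0 <= p by rewrite -(pmulr_rge0 _ g0) (le_trans _ cp) // Apsd.2.
have sp : dot (S *m s) s <= (g - 1) * p by move: cp; rewrite /p; lra.
have := smoother_energy_bound smoothing_block_psd Spos Munit Nunit smooth_lower
  smooth_upper k1  x g1 p0 sp.
rewrite Ss -/N.
have -> : dot (S *m x) x + 2 * dot r x + c = dot (S *m (x + s)) (x + s) + p.
  rewrite mulmxDr !(dotDl, dotDr) (psd_sym s x smoothing_block_psd) /p Ss.
  have -> : dot (S *m x) s = dot r x by rewrite (psd_sym x s smoothing_block_psd) Ss.
  by rewrite (dotC r x); ring.
have := smoothing_block_psd.2 (x + s); set t := dot _ (x + s) => t0 zb.
apply: (le_trans (lerD zb Dy)).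
have tc := ler_wpM2l (le_trans ler01 tau1) cp.
have gt : 0 <= g * t * (tau - 1) by rewrite !mulr_ge0 ?subr_ge0 // ltW.
rewrite -/c; lra.
Qed.

End TwoLevel.

Lemma quotient_bounds (R : realType) (a b hi : R) :
  0 <= b -> 1 <= a / b <= hi -> [/\ 0 < b, b <= a & a <= hi * b].
Proof.
move=> b0 /andP[ge1 lehi].
have b_gt0 : 0 < b.
  rewrite lt_def b0 andbT; apply: contraTneq ge1 => ->.
  by rewrite invr0 mulr0 ler10.
by move: ge1 lehi; rewrite ler_pdivlMr // mul1r ler_pdivrMr.
Qed.

Lemma mean_zero_neq0 (R : realType) m : (1 < m)%N ->
  exists2 w : 'cV[R]_m, w != 0 & dot w ones = 0.
Proof.
case: m => [|[|m]] // _; exists (delta_mx 0 0 - delta_mx 1 0).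
  apply/eqP => /matrixP/(_ 0 0)/eqP.
  by rewrite !mxE !eqxx /= subr0 oner_eq0.
have dot_delta (k : 'I_m.+2) : dot (delta_mx k 0) (ones : 'cV[R]_m.+2) = 1.
  rewrite /dot (bigD1 k) //= !mxE !eqxx mulr1 big1 ?addr0 // => l lk.
  by rewrite !mxE (negPf lk) mul0r.
by rewrite dotBl !dot_delta subrr.
Qed.

(** A vector [Y x + P y] of zero energy is constant by connectedness, hence [x]
is zero and [y] is both constant and of mean zero. *)
Lemma Ahat_gt0 (R : realType) n m (e : rel 'I_n) (i j : 'I_m -> 'I_n)
    (x y : 'cV[R]_m) :
  let A := laplacian R e in let Y := Ymx i j R in let P := Pmx i j R in
  simple_graph e -> connected_graph e -> perfect_matching e i j -> (0 < m)%N ->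
  col_mx x y != 0 -> dot y ones = 0 ->
  0 < dot (Ahat A Y P *m col_mx x y) (col_mx x y).
Proof.
move=> A Y P esimple econ ematch m_gt0 v0 y1.
have Apsd : psd A := laplacian_psd R e.
rewrite Ahat_energyE lt_def Apsd.2 andbT; apply: contra v0 => /eqP.
rewrite laplacianE => w_flat.
have := lap_form_eq0 esimple (i (Ordinal m_gt0)) econ w_flat.
case/(block_const esimple ematch) => -> yE; move: y1; rewrite yE dotZl.
move/eqP; rewrite mulf_eq0 => /orP[/eqP->|/eqP]; first by rewrite scale0r col_mx0.
rewrite /dot (eq_bigr (fun=> 1)) => [|k _]; last by rewrite !mxE mulr1.
by rewrite sumr_const card_ord => /eqP; rewrite pnatr_eq0 eqn0Ngt m_gt0.
Qed.

Theorem theorem4p5 (R : realType) (n : nat) (e : rel 'I_n)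
    (i j : 'I_(n./2) -> 'I_n) (M D : 'M[R]_(n./2)) (kappa_s eta : R)
    (hat1 : 'cV[R]_(n./2 + n./2)) :
  let A := laplacian R e in
  let P := Pmx i j R in
  let Y := Ymx i j R in
  let Ac := laplacian R (coarse_graph e i j) in
  let Q := range_proj P in
  let sigma := coarse_sigma A P Ac in
  (4 <= n)%N ->
  simple_graph e ->
  connected_graph e ->
  perfect_matching e i j ->
  row_mx Y P *m hat1 = ones ->
  M \in unitmx ->
  M + M^T - Y^T *m A *m Y \in unitmx ->
  psd D ->
  (forall u : 'cV[R]_(n./2), u != 0 ->
     1 <= dot (invmx (M^T + M - Y^T *m A *m Y) *m (M *m u)) (M *m u)
          / dot (A *m (Y *m u)) (Y *m u) <= kappa_s) ->
  (forall w : 'cV[R]_(n./2), w != 0 -> dot w ones = 0 ->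
     1 <= dot (D *m w) w / dot (Ac *m w) w <= eta) ->
  forall v : 'cV[R]_(n./2 + n./2), v != 0 -> dot v hat1 = 0 ->
    1 <= dot (Bhat A Y P M D sigma *m v) v / dot (Ahat A Y P *m v) v
      <= (kappa_s + sigma * eta - 1) * op_energy_norm A Q ^+ 2.
Proof.
move=> A P Y Ac Q sigma n4 esimple econ ematch hat1E Munit Nunit Dpsd smooth coarse.
move=> v v0 v1; have Apsd : psd A := laplacian_psd R e.
have Acpsd : psd Ac := laplacian_psd R _.
have m2 : (2 <= n./2)%N := half_leq n4.
have m_gt0 : (0 < n./2)%N := ltnW m2.
pose S := Y^T *m A *m Y.
have SE u : dot (S *m u) u = dot (A *m (Y *m u)) (Y *m u).
  by rewrite /S -!mulmxA dotM trmxK.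
have smoothP u : u != 0 -> [/\ 0 < dot (S *m u) u,
    dot (S *m u) u <= dot (invmx (M + M^T - S) *m (M *m u)) (M *m u)
  & dot (invmx (M + M^T - S) *m (M *m u)) (M *m u) <= kappa_s * dot (S *m u) u].
  move=> u0; rewrite SE (addrC M); apply: quotient_bounds => //; last exact: smooth.
  exact: Apsd.2.
have smooth0 : dot (invmx (M + M^T - S) *m (M *m 0)) (M *m 0) = 0 :> R.
  by rewrite !mulmx0 dot0l.
have Spos u : u != 0 -> 0 < dot (S *m u) u by case/smoothP.
have lower u : dot (S *m u) u <= dot (invmx (M + M^T - S) *m (M *m u)) (M *m u).
  by have [->|/smoothP[]//] := eqVneq u 0; rewrite smooth0 mulmx0 dot0l.
have upper u : dot (invmx (M + M^T - S) *m (M *m u)) (M *m u)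
    <= kappa_s * dot (S *m u) u.
  by have [->|/smoothP[]//] := eqVneq u 0; rewrite smooth0 mulmx0 dot0l mulr0.
have coarseP w : w != 0 -> dot w ones = 0 -> [/\ 0 < dot (Ac *m w) w,
    dot (Ac *m w) w <= dot (D *m w) w & dot (D *m w) w <= eta * dot (Ac *m w) w].
  by move=> w0 w1; apply: quotient_bounds => //; [exact: Acpsd.2|exact: coarse].
have aggr w : dot (Ac *m w) w <= dot (A *m (P *m w)) (P *m w)
    <= 4 * dot (Ac *m w) w.
  by rewrite !laplacianE; apply: coarse_energy_le.
have sigmaP w : w != 0 -> dot w ones = 0 ->
    dot (A *m (P *m w)) (P *m w) <= sigma * dot (Ac *m w) w.
  apply: coarse_sigma_bound => u u0 u1; have [Ac_gt0 _ _] := coarseP u u0 u1.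
  by split=> //; have /andP[_] := aggr u; apply.
have QP w : dot (A *m (Q *m w)) (Q *m w)
    <= op_energy_norm A Q ^+ 2 * dot (A *m w) w.
  apply: op_energy_norm_bound Apsd _ => u; rewrite !laplacianE.
  exact: range_proj_energy_le.
(* The constants sigma, eta and kappa_s are at least 1 only because there is a
   nonzero vector of mean zero, which takes two matched pairs. *)
have [w0 w0_neq0 w01] := @mean_zero_neq0 R _ m2.
have [Ac0 DAc etaP] := coarseP _ w0_neq0 w01.
have [Pge _] := andP (aggr w0); have sigma0 := sigmaP _ w0_neq0 w01.
have sigma1 : 1 <= sigma by rewrite -(ler_pM2r Ac0) mul1r (le_trans Pge).
have eta1 : 1 <= eta by rewrite -(ler_pM2r Ac0) mul1r (le_trans DAc).
have kappa1 : 1 <= kappa_s.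
  have [S0 l0 u0] := smoothP _ w0_neq0.
  by rewrite -(ler_pM2r S0) mul1r (le_trans l0).
(* Q fixes [P w0], whose energy is positive. *)
have g1 : 1 <= op_energy_norm A Q ^+ 2.
  have P0 : 0 < dot (A *m (P *m w0)) (P *m w0) := lt_le_trans Ac0 Pge.
  rewrite -(ler_pM2r P0) mul1r; have := QP (P *m w0).
  have := range_projE esimple ematch 0 w0.
  by rewrite mulmx0 add0r => ->.
have hat1_blocks : hat1 = col_mx 0 ones.
  move: hat1E; rewrite -(vsubmxK hat1) mul_row_col -[ones]scale1r.
  by case/(block_const esimple ematch) => -> ->; rewrite scale1r.
move: v0 v1; rewrite -(vsubmxK v); set x := usubmx v; set y := dsubmx v => v0.
rewrite hat1_blocks dot_col_mx dotC dot0l add0r => y1.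
have den_gt0 := Ahat_gt0 esimple econ ematch m_gt0 v0 y1.
have sigma_ge0 : 0 <= sigma := le_trans ler01 sigma1.
rewrite ler_pdivlMr // ler_pdivrMr // mul1r; apply/andP; split.
  apply: two_level_lower => //.
  have [->|yn0] := eqVneq y 0; first by rewrite !mulmx0 !dot0l mulr0.
  apply: (le_trans (sigmaP y yn0 y1)); apply: ler_wpM2l => //.
  by case: (coarseP y yn0 y1).
apply: two_level_upper => //.
- by rewrite -[1]mulr1 ler_pM.
- move=> u; have := QP (Y *m u + P *m y).
  by rewrite (range_projE esimple ematch).
have [->|yn0] := eqVneq y 0; first by rewrite !mulmx0 !dot0l !mulr0.
rewrite -mulrA; apply: ler_wpM2l => //.
have [_ _ /le_trans-> //] := coarseP y yn0 y1.
apply: ler_wpM2l; first exact: le_trans ler01 eta1.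
by have /andP[] := aggr y.
Qed.
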